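(* Let $q\ge 5$ be an odd prime power. Suppose that either $q\equiv 3\pmod 4$, $\frac{q+1}{2}\le t\le q-1$ and $t\ne\frac{q+3}{2}$; or $q\equiv 1\pmod 4$, $\frac{q-1}{2}\le t\le q-1$ and $t\ne \frac{q+1}{2}$. Then \[ r\bigl(C_4,B_{(q-1)^2+(t-2)}\bigr)=q^2+t. \]
   Context: For graphs $H_1,H_2$, the Ramsey number $r(H_1,H_2)$ is the smallest integer $N$ such that for every graph $G$ on $N$ vertices, either $G$ contains $H_1$ as a subgraph or the complement $\overline{G}$ contains $H_2$ as a subgraph. $C_4$ denotes the cycle of length 4. For $n\ge 1$, the book $B_n$ is the graph consisting of $n$ triangles sharing a common edge. Here $t$ is an integer. *)

(* Defs.v *)
From mathcomp Require Import all_boot.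

Set Implicit Arguments.
Unset Strict Implicit.
Unset Printing Implicit Defensive.

Record sgraph := SGraph {
  vertex : finType;
  adj : rel vertex;
  adj_sym : symmetric adj;
  adj_irr : irreflexive adj
}.

Section Complement.
Variable G : sgraph.

Definition compl_adj : rel (vertex G) := [rel x y | (x != y) && ~~ adj x y].

Fact compl_adj_sym : symmetric compl_adj.
Proof. by move=> x y; rewrite /compl_adj /= eq_sym adj_sym. Qed.

Fact compl_adj_irr : irreflexive compl_adj.
Proof. by move=> x; rewrite /compl_adj /= eqxx. Qed.

Definition compl_graph : sgraph := SGraph compl_adj_sym compl_adj_irr.

End Complement.

(* [G] contains a copy of [H] as a not necessarily induced subgraph. *)
Definition has_subgraph (G H : sgraph) : Prop :=
  exists f : vertex H -> vertex G,
    injective f /\ (forall x y, adj x y -> adj (f x) (f y)).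

Section Cycle.
Variable n : nat.

(* [ordS] is the cyclic successor of 'I_n, so this is the n-cycle for n >= 3;
   the conjunct [i != j] only matters for n = 1. *)
Definition cycle_adj : rel 'I_n :=
  [rel i j | (i != j) && ((j == ordS i) || (i == ordS j))].

Fact cycle_adj_sym : symmetric cycle_adj.
Proof. by move=> i j; rewrite /cycle_adj /= eq_sym orbC. Qed.

Fact cycle_adj_irr : irreflexive cycle_adj.
Proof. by move=> i; rewrite /cycle_adj /= eqxx. Qed.

Definition cycle_graph : sgraph := SGraph cycle_adj_sym cycle_adj_irr.

End Cycle.

Section Book.
Variable n : nat.

(* The two [inl] vertices span the common edge; each [inr] vertex is the apex
   of one of the n triangles. *)
Definition book_adj : rel ('I_2 + 'I_n)%type :=
  fun u v => match u, v with
             | inl a, inl b => a != b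
             | inl _, inr _ | inr _, inl _ => true
             | inr _, inr _ => false
             end.

Fact book_adj_sym : symmetric book_adj.
Proof. by move=> [a|i] [b|j] //=; rewrite eq_sym. Qed.

Fact book_adj_irr : irreflexive book_adj.
Proof. by move=> [a|i] //=; rewrite eqxx. Qed.

Definition book_graph : sgraph := SGraph book_adj_sym book_adj_irr.

End Book.

Definition ramsey_prop (H1 H2 : sgraph) (N : nat) : Prop :=
  forall G : sgraph, #|vertex G| = N ->
    has_subgraph G H1 \/ has_subgraph (compl_graph G) H2.

(* r(H1, H2) = N, expressed relationally. *)
Definition is_ramsey_number (H1 H2 : sgraph) (N : nat) : Prop :=
  ramsey_prop H1 H2 N /\ (forall M, ramsey_prop H1 H2 M -> N <= M).

Definition prime_power (q : nat) : Prop :=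
  exists p k : nat, [/\ prime p, 0 < k & q = p ^ k].

(* Main.v *)
Require Import Defs.
From mathcomp Require Import all_boot.
From mathcomp Require Import all_algebra fingroup cyclic finfield.
From mathcomp Require Import zify ring.

Set Implicit Arguments.
Unset Strict Implicit.
Unset Printing Implicit Defensive.
Import GRing.Theory.

(** Write n for the book parameter. A graph on N vertices has no B_n in its
    complement iff |N(x) ∪ N(y)| >= N - 1 - n for all non-adjacent x <> y.

    Upper bound: here N - 1 - n = 2q. In a C_4-free graph the numbers
    d(w) - 1, for w adjacent to v, add up to at most N - 1, so v has at most q
    neighbours of degree > q. Hence no vertex can have degree < q, and if all
    degrees are >= q then a vertex of degree > q has two neighbours of degree
    q. Two vertices of degree q with a common neighbour are adjacent, which
    forces a vertex of degree q to have degree at most 2.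

    Lower bound: a C_4-free graph with q^2 + t - 1 vertices and all degrees
    >= q suffices. Take the nonzero vectors of F_q^2, with v ~ w iff v.w = 1,
    and t points at infinity, indexed by slopes, with v ~ slope(v) and each
    slope adjacent to the perpendicular one. This is the Erdős–Rényi polarity
    graph without its vertex (0:0:1) and q + 1 - t of the neighbours of that
    vertex. All degrees are >= q as soon as the set of slopes is stable under
    perpendicularity, has no isotropic slope and contains the slopes of all
    vectors of norm 1. For odd t, one further slope e is joined to a slope a
    that is not the slope of a norm 1 vector, and the edges v ~ w with
    slope(v) = a, slope(w) = e, which would close a 4-cycle, are removed. *)

(** * Books and 4-cycles in terms of neighbourhoods *)

Definition nbr (G : sgraph) (x : vertex G) : {set vertex G} :=
  [set y | adj x y].

Definition codeg_le1 (G : sgraph) := forall x y : vertex G,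
  x != y -> #|nbr x :&: nbr y| <= 1.

Section Neighbourhoods.
Variable G : sgraph.
Implicit Types x y : vertex G.

Lemma in_nbr x y : (y \in nbr x) = adj x y.
Proof. by rewrite inE. Qed.

Lemma nbr_sym x y : (y \in nbr x) = (x \in nbr y).
Proof. by rewrite !in_nbr adj_sym. Qed.

Lemma common_nbr_eq x y a b : codeg_le1 G -> x != y ->
  adj x a -> adj y a -> adj x b -> adj y b -> a = b.
Proof.
move=> c4 xy xa ya xb yb; apply: (card_le1_eqP (c4 x y xy)).
  by rewrite in_setI !in_nbr xb.
by rewrite in_setI !in_nbr xa.
Qed.

Lemma has_C4P : reflect (has_subgraph G (cycle_graph 4))
  [exists x : vertex G, [exists y : vertex G,
    (x != y) && (1 < #|nbr x :&: nbr y|)]].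
Proof.
apply: (iffP existsP) => [[x /existsP[y /andP[xy]]]|[f [finj fadj]]].
  move=> /card_gt1P[a [b []]].
  rewrite !in_setI !in_nbr => /andP[xa ya] /andP[xb yb] ab.
  have neq u v : adj u v -> u != v by apply: contraTneq => ->; rewrite adj_irr.
  pose s := [:: x; a; y; b].
  have us : uniq s.
    by rewrite /= !inE !negb_or xy ab !neq // adj_sym.
  exists (fun i : 'I_4 => nth x s i); split.
    by move=> i j /eqP; rewrite nth_uniq // => /eqP /val_inj.
  by case=> [[|[|[|[|?]]]] ?] // [[|[|[|[|?]]]] ?] //= _; rewrite // adj_sym.
have lt i : i < 4 -> i < 4 by [].
pose o i (h : i < 4) : vertex (cycle_graph 4) := Ordinal h.
exists (f (o 0 isT)); apply/existsP; exists (f (o 2 isT)).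
rewrite (inj_eq finj) /=; apply/card_gt1P.
exists (f (o 1 isT)), (f (o 3 isT)); rewrite !in_setI !in_nbr (inj_eq finj).
by split=> //; apply/andP; split; apply: fadj.
Qed.

Lemma codeg_le1P : codeg_le1 G <-> ~ has_subgraph G (cycle_graph 4).
Proof.
split=> [c4 /has_C4P/existsP[x /existsP[y /andP[/c4]]]|noC4 x y xy].
  by rewrite leqNgt => /negP.
rewrite leqNgt; apply/negP => h; apply/noC4/has_C4P.
by apply/existsP; exists x; apply/existsP; exists y; rewrite xy.
Qed.

End Neighbourhoods.

Section Books.
Variable G : sgraph.
Implicit Types x y : vertex G.

(** As [x] and [y] are non-adjacent, both lie outside [nbr x :|: nbr y]; the remaining vertices
    outside it are the possible pages of a book on [x] and [y]. *)
Lemma card_common_nonnbr x y : x != y -> ~~ adj x y ->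
  #|nbr (G := compl_graph G) x :&: nbr (G := compl_graph G) y|
    + #|nbr x :|: nbr y| + 2 = #|vertex G|.
Proof.
move=> xy xNy; have Nxy := adj_sym y x; rewrite (negbTE xNy) in Nxy.
rewrite -(cardsC (nbr x :|: nbr y)) addnAC addnC; congr (_ + _).
rewrite [RHS](cardsD1 x) [X in _ = _ + X](cardsD1 y) addnC addnA !inE.
rewrite !adj_irr Nxy (negbTE xNy) eq_sym xy /=; congr (_ + _).
apply: eq_card => z; rewrite !inE /= /compl_adj /= -!(eq_sym z).
by rewrite negb_or; do 2!case: (_ == _); do 2!case: (adj _ _).
Qed.

Lemma has_coBookP n : has_subgraph (compl_graph G) (book_graph n) <->
  exists x y, [/\ x != y, ~~ adj x y &
    n + #|nbr x :|: nbr y| + 2 <= #|vertex G|].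
Proof.
split=> [[f [finj fadj]]|[x [y [xy xNy]]]].
  pose a : vertex (book_graph n) := inl ord0.
  pose b : vertex (book_graph n) := inl ord_max.
  have /fadj /andP[xy xNy] : adj a b by [].
  exists (f a), (f b); split=> //; rewrite -(card_common_nonnbr xy xNy).
  rewrite !leq_add2r -{1}[n]card_ord.
  rewrite -(card_imset _ (inj_comp finj (@inr_inj _ _))).
  apply/subset_leq_card/subsetP => _ /imsetP[i _ ->].
  by rewrite in_setI !in_nbr; apply/andP; split; apply: fadj.
rewrite -(card_common_nonnbr xy xNy) !leq_add2r => hn.
set Z := _ :&: _ in hn.
pose g (i : 'I_n) := enum_val (widen_ord hn i).
have gP i :
    adj (s := compl_graph G) x (g i) /\ adj (s := compl_graph G) y (g i).
  have := enum_valP (widen_ord hn i); rewrite in_setI !in_nbr.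
  by case/andP.
have gN i : g i != x /\ g i != y.
  by case: (gP i) => /andP[? _] /andP[? _]; split; rewrite eq_sym.
pose f (w : vertex (book_graph n)) : vertex (compl_graph G) :=
  match w with inl j => if j == ord0 then x else y | inr i => g i end.
have I2 (j : 'I_2) : j <> ord0 -> j = ord_max.
  by case: j => [[|[|j]] hj] // h; [case: h|]; apply: val_inj.
exists f; split.
  have gx i : g i <> x by case: (gN i) => /eqP.
  have gy i : g i <> y by case: (gN i) => _ /eqP.
  case=> [j|i] [j'|i'] /=.
  - case: eqP => [->|hj]; case: eqP => [->|hj'] // h.
    + by rewrite h eqxx in xy.
    + by rewrite h eqxx in xy.
    by rewrite (I2 j hj) (I2 j' hj').
  - by case: ifP => _ /esym h; [case: (gx i') | case: (gy i')].
  - by case: ifP => _ h; [case: (gx i) | case: (gy i)].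
  by move/enum_val_inj => h; congr inr; apply: val_inj; case: h.
have xyC : adj (s := compl_graph G) x y by rewrite /= /compl_adj /= xy.
case=> [j|i] [j'|i'] //=.
- case: (j =P ord0) => [->|/I2 jE]; case: (j' =P ord0) => [->|/I2 jE'] //=;
    last by rewrite jE jE'.
  by rewrite compl_adj_sym.
- by case: ifP => _ _; case: (gP i').
by case: ifP => _ _; case: (gP i); rewrite compl_adj_sym.
Qed.

End Books.

(** Pass to the induced subgraph on [M] vertices. Thus one graph without the Ramsey property rules
    out all smaller orders as well. *)
Lemma ramsey_prop_mono H1 H2 M N : ramsey_prop H1 H2 M -> M <= N ->
  ramsey_prop H1 H2 N.
Proof.
move=> rM MN G cG.
have hM : M <= #|vertex G| by rewrite cG.
pose g (i : 'I_M) : vertex G := enum_val (widen_ord hM i).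
have ginj : injective g.
  by move=> i j /enum_val_inj h; apply: val_inj; case: h.
have gsym : symmetric (relpre g (@adj G)) by move=> i j /=; rewrite adj_sym.
have girr : irreflexive (relpre g (@adj G)) by move=> i /=; rewrite adj_irr.
have [] := rM (SGraph gsym girr) (card_ord M).
  by case=> f [finj fadj]; left; exists (g \o f); split; [exact: inj_comp|].
case=> f [finj fadj]; right; exists (g \o f); split; first exact: inj_comp.
move=> x y /fadj /= /andP[h1 h2].
by rewrite /compl_adj /= (inj_eq ginj) h1.
Qed.

(** * Upper bound *)

Section UpperBound.
Variables (G : sgraph) (q n : nat).
Implicit Types v w x y z : vertex G.
Hypothesis c4 : codeg_le1 G.
Hypothesis cardG : #|vertex G| = n.
Local Notation d v := #|nbr v|.

(* Distinct neighbours of [v] have no common neighbour besides [v]. *)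
Lemma sum_deg_nbr v : \sum_(w in nbr v) (d w).-1 < n.
Proof.
rewrite (eq_bigr (fun w => \sum_(z | (z != v) && adj w z) 1)); last first.
  move=> w; rewrite nbr_sym => vw; rewrite (cardsD1 v) vw /= sum1_card.
  by apply: eq_card => z; rewrite !inE.
rewrite (exchange_big_dep [pred z | z != v]) /=; last by move=> ? ? _ /andP[].
apply: (@leq_ltn_trans (\sum_(z | z != v) 1)).
  apply: leq_sum => z zv; rewrite sum1_card; apply: leq_trans (c4 zv).
  apply: subset_leq_card; apply/subsetP => w.
  by rewrite unfold_in !inE zv /= (adj_sym z) andbC.
rewrite sum1_card (cardC1 v) -cardG ltn_predL; by apply/card_gt0P; exists v.
Qed.

Hypothesis n_le : n <= q ^ 2 + q - 1.

Let high : {set vertex G} := [set w | q < d w].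

(** Already [q + 1] high neighbours would contribute [q * (q + 1)], more than [sum_deg_nbr]
    allows. *)
Lemma card_high_nbr v : #|nbr v :&: high| <= q.
Proof.
rewrite leqNgt; apply/negP => lt.
have := sum_deg_nbr v; rewrite (big_setID high) /= ltnNge => /negP; apply.
apply: leq_trans (leq_addr _ _).
apply: (@leq_trans (\sum_(w in nbr v :&: high) q)).
  have := n_le; have := leq_mul lt (leqnn q); rewrite sum_nat_const -mulnn; lia.
by apply: leq_sum => w; rewrite !inE => /andP[_]; lia.
Qed.

Hypothesis nonadj : forall x y, x != y -> ~~ adj x y ->
  2 * q <= #|nbr x :|: nbr y|.

Lemma deg_add_nonadj x y : x != y -> ~~ adj x y ->
  2 * q + #|nbr x :&: nbr y| <= d x + d y.
Proof. by move=> xy /(nonadj xy); rewrite -cardsUI leq_add2r. Qed.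

(** If [d x < q], take [v] non-adjacent to [x]. A neighbour of [v] of degree at most [q] must be
    adjacent to [x], so [d v <= q + #|nbr x :&: nbr v|]; but [deg_add_nonadj] makes [d v] larger
    than that. *)
Lemma low_deg_ge x : q ^ 2 <= n -> 2 < q -> q <= d x.
Proof.
move=> n_ge q_gt; rewrite leqNgt; apply/negP => dx.
have [v] : exists v, v \notin x |: nbr x.
  apply/existsP; rewrite -negb_forall; apply/negP => /forallP h.
  have : n <= #|x |: nbr x|.
    by rewrite -cardG -cardsT; apply: subset_leq_card; apply/subsetP => z _.
  rewrite -mulnn in n_ge; rewrite cardsU1; nia.
rewrite !inE negb_or eq_sym => /andP[xv xNv].
have dv := deg_add_nonadj xv xNv.
have low_sub : nbr v :\: high \subset nbr x :&: nbr v.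
  apply/subsetP => y; rewrite !inE -leqNgt => /andP[dy vy]; rewrite vy andbT.
  apply/negPn/negP => xNy.
  have xy : x != y by apply: contraNneq xNv => ->; rewrite adj_sym.
  have := deg_add_nonadj xy xNy; lia.
have := subset_leq_card low_sub; have := card_high_nbr v.
have := cardsID high (nbr v); lia.
Qed.

(** Otherwise at least [q] neighbours of [v] contribute [q] each and [x] contributes [q - 1] to
    [sum_deg_nbr], which reaches [n]. *)
Lemma second_low_nbr v x : (forall w, q <= d w) -> q < d v ->
  d x <= q -> adj v x -> exists y, [/\ adj v y, y != x & d y <= q].
Proof.
move=> dge dv dx vx; have [/existsP[y /and3P[]]|] := boolP [exists y : vertex G,
  [&& adj v y, y != x & d y <= q]]; first by exists y.
rewrite negb_exists => /forallP only_x; exfalso.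
have highP : nbr v :\ x \subset high.
  apply/subsetP => y; rewrite !inE => /andP[yx vy]; rewrite ltnNge.
  by have := only_x y; rewrite vy yx.
have := sum_deg_nbr v.
rewrite (big_setD1 x) /= ?in_nbr // ltnNge => /negP; apply.
have : \sum_(w in nbr v :\ x) q <= \sum_(w in nbr v :\ x) (d w).-1.
  by apply: leq_sum => w /(subsetP highP); rewrite inE; lia.
have := dge x; rewrite (cardsD1 x (nbr v)) in_nbr vx in dv.
have := n_le; rewrite sum_nat_const -mulnn; nia.
Qed.

(** If [d x <= q], then [x] has a neighbour [y] of degree at most [q], and every other neighbour of
    [x] is adjacent to [y]; by [c4] this leaves [d x <= 2]. *)
Lemma deg_gt x : (forall v, q <= d v) -> 2 < q -> q < d x.
Proof.
move=> dge q_gt; rewrite ltnNge; apply/negP => dx.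
(* If non-adjacent, [y] and [z] would have degree sum at least [2 * q + 1] because of [w]. *)
have low_adj y z w : y != z -> d y <= q -> d z <= q -> adj y w -> adj z w ->
    adj y z.
  move=> yz dy dz yw zw; apply/negPn/negP => yNz.
  have := deg_add_nonadj yz yNz.
  have : 0 < #|nbr y :&: nbr z| by apply/card_gt0P; exists w; rewrite !inE yw.
  lia.
have other w : adj x w -> q < d w -> exists y, [/\ adj w y, y != x & d y <= q].
  by rewrite adj_sym => wx dw; apply: second_low_nbr.
have [y xy dy] : exists2 y, adj x y & d y <= q.
  have /card_gt0P[w] : 0 < d x by have := dge x; lia.
  rewrite in_nbr => xw; have [dw|dw] := leqP (d w) q; first by exists w.
  have [y [wy yx dy]] := other w xw dw; exists y => //.
  by apply: (low_adj _ _ w); rewrite // 1?eq_sym // adj_sym.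
suff : nbr x :\ y \subset nbr x :&: nbr y.
  have xNy : x != y by apply: contraTneq xy => ->; rewrite adj_irr.
  move/subset_leq_card => h; have := leq_trans h (c4 xNy).
  have := dge x; rewrite (cardsD1 y) in_nbr xy; lia.
apply/subsetP => w; rewrite !inE => /andP[wy xw]; rewrite xw /=.
have [dw|dw] := leqP (d w) q.
  by apply: (low_adj _ _ x); rewrite // 1?eq_sym // adj_sym.
(* Unless [z = y], the vertices [x], [y], [z] form a triangle, and [w] and [y] are two common
   neighbours of [x] and [z]. *)
have [z [wz zx dz]] := other w xw dw.
have [<-|zy] := eqVneq z y; first by rewrite adj_sym.
have xz : adj x z by apply: (low_adj _ _ w); rewrite // 1?eq_sym // adj_sym.
have yz : adj y z.
  by apply: (low_adj _ _ x); rewrite // 1?eq_sym // adj_sym.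
case/eqP: wy; apply: (common_nbr_eq c4 (x := x) (y := z)) => //.
- by rewrite eq_sym.
- by rewrite adj_sym.
by rewrite adj_sym.
Qed.

End UpperBound.

Lemma upper_bound q t n : 2 < q -> t < q -> n + 2 * q + 1 = q ^ 2 + t ->
  ramsey_prop (cycle_graph 4) (book_graph n) (q ^ 2 + t).
Proof.
move=> q_gt t_lt nE G cG.
have [hC4|/negP noC4] := boolP [exists x : vertex G, [exists y : vertex G,
    (x != y) && (1 < #|nbr x :&: nbr y|)]]; first by left; apply/has_C4P.
right; apply/has_coBookP.
have c4 : codeg_le1 G by apply/codeg_le1P => /has_C4P.
have [/existsP[x /existsP[y /and3P[xy xNy h]]]|noB] :=
  boolP [exists x : vertex G, [exists y : vertex G, [&& x != y, ~~ adj x y &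
    n + #|nbr x :|: nbr y| + 2 <= #|vertex G|]]]; first by exists x, y.
have nonadj (x y : vertex G) : x != y -> ~~ adj x y ->
    2 * q <= #|nbr x :|: nbr y|.
  move=> xy xNy; rewrite leqNgt; apply: contra noB => h.
  apply/existsP; exists x; apply/existsP; exists y; rewrite xy xNy cG /=; lia.
have n_le : q ^ 2 + t <= q ^ 2 + q - 1 by lia.
have dge (x : vertex G) : q <= #|nbr x|.
  by apply: (low_deg_ge c4 cG n_le nonadj); first exact: leq_addr.
have dgt (x : vertex G) : q < #|nbr x|.
  exact: (deg_gt c4 cG n_le nonadj).
have /card_gt0P[v _] : 0 < #|vertex G| by rewrite cG; lia.
(* All neighbours of [v] are high and there are more than [q] of them. *)
have := card_high_nbr c4 cG n_le v.
have -> : nbr v :&: [set w | q < #|nbr w|] = nbr v.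
  by apply/setP => w; rewrite !inE dgt andbT.
by rewrite leqNgt dgt.
Qed.

(** * Lower bound *)

(** Two neighbourhoods share at most one vertex, so their union has at least [2 * q - 1] elements
    and fewer than [n] pages remain. *)
Lemma min_deg_not_ramsey (G : sgraph) q n : codeg_le1 G ->
  (forall x : vertex G, q <= #|nbr x|) -> #|vertex G| < n + 2 * q + 1 ->
  ~ ramsey_prop (cycle_graph 4) (book_graph n) #|vertex G|.
Proof.
move=> c4 dge ltN /(_ G erefl)[hC4|/has_coBookP[x [y [xy _ hB]]]].
  exact: (codeg_le1P G).1 c4 hC4.
have := cardsUI (nbr x) (nbr y); have := c4 x y xy.
have := dge x; have := dge y; lia.
Qed.

(** * Sets stable under an involution *)

Section StableSets.
Variables (T : finType) (f : T -> T) (N A : {set T}).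
Hypotheses (fK : involutive f) (fN : {in N, forall x, f x \in N}).
Hypotheses (f_neq : {in N, forall x, f x != x}).
Hypotheses (fA : {in A, forall x, f x \in A}) (AN : A \subset N).

(** Add two-element orbits [{x, f x}] one at a time, those inside [A] first. The invariant that [R]
    is comparable with [A] gives [A \subset R] at the end, since [#|A| <= k.*2]. *)
Lemma exists_stable_set k : #|A| <= k.*2 <= #|N| ->
  exists R : {set T}, [/\ #|R| = k.*2, A \subset R, R \subset N &
    {in R, forall x, f x \in R}].
Proof.
case/andP=> Ak kN.
suff [R [cR RN fR [AR|RA]]] : exists R : {set T}, [/\ #|R| = k.*2, R \subset N,
    {in R, forall x, f x \in R} & A \subset R \/ R \subset A].
- by exists R.
- by exists R; split=> //; rewrite (eqP (_ : R == A)) // eqEcard RA cR.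
elim: k kN {Ak} => [_|k IHk kN].
  exists set0; rewrite cards0 !sub0set; split=> //; last by right.
  by move=> x; rewrite inE.
have [|R [cR RN fR cmp]] := IHk.
  by apply: leq_trans kN; rewrite leq_double.
have [x [xN xR cmpx]] : exists x, [/\ x \in N, x \notin R &
    A \subset x |: (f x |: R) \/ x |: (f x |: R) \subset A].
  have [AR|AR] := boolP (A \subset R).
    have [|x xN xR] := (@properP _ (mem R) (mem N) _).2.
      by rewrite properEcard RN cR; apply: leq_trans kN; rewrite ltn_double.
    by exists x; split=> //; left; rewrite (subset_trans AR) // setUA subsetUr.
  have {cmp} RA : R \subset A by case: cmp => // AR'; rewrite AR' in AR.
  have /subsetPn[x xA xR] := AR.
  exists x; split=> //; first exact: (subsetP AN).
  by right; rewrite !subUset !sub1set xA fA.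
have fxR : f x \notin R by apply: contra xR => /fR; rewrite fK.
exists (x |: (f x |: R)); split=> //.
- by rewrite !cardsU1 !inE negb_or eq_sym f_neq // xR fxR cR.
- by rewrite !subUset !sub1set xN fN.
move=> y; rewrite !inE => /or3P[/eqP->|/eqP->|/fR->].
- by rewrite eqxx orbT.
- by rewrite fK eqxx.
by rewrite !orbT.
Qed.

End StableSets.

(** * Slopes and lines in the plane over a finite field *)

Section Plane.
Variable F : finFieldType.
Local Notation vec := (F * F)%type.
Implicit Types (v w a b : vec) (s : option F).
Local Open Scope ring_scope.

Definition dot v w := v.1 * w.1 + v.2 * w.2.
(** [None] is the vertical slope; at the zero vector it is a default value. *)
Definition slope v := if v.1 == 0 then None else Some (v.2 / v.1).
Definition dir s : vec := if s is Some a then (1, a) else (0, 1).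
Definition perp s : option F :=
  if s is Some a then if a == 0 then None else Some (- a^-1) else Some 0.

Lemma dotC v w : dot v w = dot w v.
Proof. by rewrite /dot; ring. Qed.

Lemma slopeP v : v != 0 ->
  exists2 c, c != 0 & v = (c * (dir (slope v)).1, c * (dir (slope v)).2).
Proof.
case: v => x y v0; rewrite /slope /=; case: eqP => [x0|/eqP x0] /=.
  exists y; last by rewrite x0 mulr0 mulr1.
  by apply: contraNneq v0 => y0; rewrite x0 y0.
by exists x; rewrite // mulr1 mulrC divfK.
Qed.

Lemma slope_dir s c : c != 0 -> slope (c * (dir s).1, c * (dir s).2) = s.
Proof.
move=> c0; rewrite /slope; case: s => [a|] /=; last by rewrite mulr0 eqxx.
by rewrite mulr1 (negbTE c0) mulrC mulKf.
Qed.

Lemma dir_neq0 s c : c != 0 -> (c * (dir s).1, c * (dir s).2) != 0 :> vec.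
Proof.
move=> c0; apply/eqP; case: s => [a|] /= [] => [/eqP|_ /eqP].
  by rewrite mulr1 (negbTE c0).
by rewrite mulr1 (negbTE c0).
Qed.

Lemma perpK : involutive perp.
Proof.
case=> [a|] /=; last by rewrite eqxx.
case: eqP => [->//|/eqP a0] /=.
by rewrite oppr_eq0 invr_eq0 (negbTE a0) invrN invrK opprK.
Qed.

Lemma dot_dir_eq0 s s' : (dot (dir s) (dir s') == 0) = (s' == perp s).
Proof.
rewrite /dot; case: s s' => [a|] [b|] /=;
  rewrite ?mulr1 ?mul1r ?mul0r ?mulr0 ?add0r ?addr0.
- case: (a =P 0) => [->|/eqP a0]; first by rewrite mul0r addr0 oner_eq0.
  rewrite (inj_eq (@Some_inj _)) addrC addr_eq0 -(inj_eq (mulfI a0) b).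
  by rewrite mulrN divff.
- by case: (a =P 0).
- by [].
by rewrite oner_eq0.
Qed.

Lemma dot_eq0 v w : v != 0 -> w != 0 ->
  (dot v w == 0) = (slope w == perp (slope v)).
Proof.
move=> /slopeP[c c0 ev] /slopeP[c' c'0 ew]; rewrite -dot_dir_eq0.
have -> : dot v w = c * c' * dot (dir (slope v)) (dir (slope w)).
  by rewrite [in LHS]ev [in LHS]ew /dot /=; ring.
by rewrite !mulf_eq0 (negbTE c0) (negbTE c'0).
Qed.

(** A line through the origin meets the line [dot v _ = 1] at most once, as the scalar in front of
    the direction is determined. *)
Lemma dot_slope_inj v w w' : w != 0 -> w' != 0 -> slope w = slope w' ->
  dot v w = 1 -> dot v w' = 1 -> w = w'.
Proof.
move=> /slopeP[c c0 ew] /slopeP[c' c'0 ew'] es e1 e1'.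
rewrite ew ew' es; suff -> : c = c' by [].
rewrite ew es in e1; rewrite ew' in e1'.
set t := dir _ in e1 e1'.
have E x : dot v (x * t.1, x * t.2) = x * dot v t by rewrite /dot /=; ring.
rewrite !E in e1 e1'.
by rewrite -[c]mulr1 -e1' mulrCA e1 mulr1.
Qed.

(** Both [w] and [w'] are orthogonal to [v - v'], hence have the same slope. *)
Lemma dot_line_inj v v' w w' : w != 0 -> w' != 0 -> v != v' ->
  dot v w = 1 -> dot v w' = 1 -> dot v' w = 1 -> dot v' w' = 1 -> w = w'.
Proof.
move=> w0 w'0 vv' e1 e2 e3 e4; apply: (dot_slope_inj w0 w'0 _ e1 e2).
have d0 : v - v' != 0 by rewrite subr_eq0.
have E u : dot (v - v') u = dot v u - dot v' u by rewrite /dot /=; ring.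
have /eqP -> : slope w == perp (slope (v - v')).
  by rewrite -dot_eq0 // E e1 e3 subrr.
by apply/eqP; rewrite eq_sym -dot_eq0 // E e2 e4 subrr.
Qed.

(** Parametrizes the line [dot v _ = 1] by the second coordinate, or by the first one if
    [v.1 = 0]. *)
Definition line_pt v (c : F) : vec :=
  if v.1 == 0 then (c, v.2^-1) else ((1 - v.2 * c) / v.1, c).

Lemma dot_line_pt v c : v != 0 -> dot v (line_pt v c) = 1.
Proof.
case: v => x y v0; rewrite /dot /line_pt /=; case: eqP => [x0|/eqP x0] /=.
  rewrite x0 mul0r add0r divff //; apply: contraNneq v0 => y0.
  by rewrite x0 y0.
by rewrite mulrC divfK // subrK.
Qed.

Lemma line_pt_inj v : injective (line_pt v).
Proof. by move=> c c'; rewrite /line_pt; case: ifP => _ []. Qed.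

Lemma dot_neq0 v w : dot v w = 1 -> w != 0.
Proof.
move=> e; apply/eqP => w0; move/eqP: e.
by rewrite w0 /dot !mulr0 addr0 eq_sym oner_eq0.
Qed.

End Plane.

(** * The graph on nonzero vectors and points at infinity *)

Section PlaneGraph.
Variable F : finFieldType.
Local Notation vec := (F * F)%type.
Implicit Types (v w a b : vec) (s z : option F).
Local Open Scope ring_scope.

Definition unit_slopes : {set option F} :=
  [set slope v | v : vec & dot v v == 1].

Lemma unit_slopeP v : dot v v = 1 -> slope v \in unit_slopes.
Proof. by move=> e; apply/imsetP; exists v; rewrite // inE e. Qed.

Variables (R : {set option F}) (M : rel (option F)).
Hypotheses (Msym : symmetric M) (Mirr : irreflexive M).

(* [inr s] is the point at infinity adjacent to the vectors of slope [s]. *)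
Definition point_ok (x : vec + option F) :=
  match x with inl v => v != 0 | inr s => s \in R end.

(** The conjunct with [M] removes the edges that would close a 4-cycle with two adjacent points at
    infinity. Perpendicular slopes lose nothing, their vectors having dot product 0. *)
Definition point_adj (x y : vec + option F) :=
  match x, y with
  | inl a, inl b => [&& a != b, dot a b == 1 & ~~ M (slope a) (slope b)]
  | inl a, inr s | inr s, inl a => slope a == s
  | inr s, inr z => M s z
  end.

Lemma point_adj_sym :
  symmetric (relpre (val : {x | point_ok x} -> _) point_adj).
Proof.
by move=> [[a|s] ?] [[b|z] ?] //=; rewrite eq_sym dotC Msym.
Qed.

Lemma point_adj_irr :
  irreflexive (relpre (val : {x | point_ok x} -> _) point_adj).
Proof. by move=> [[a|s] ?] //=; rewrite eqxx. Qed.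

Definition plane_graph := SGraph point_adj_sym point_adj_irr.

Lemma card_plane_graph : #|vertex plane_graph| = (#|F| ^ 2 - 1 + #|R|)%N.
Proof.
rewrite card_sig -[LHS]sum1_card big_sumType /=; congr (_ + _)%N; last first.
  by rewrite sum1_card.
by rewrite sum1_card -mulnn -card_prod subn1 -(cardC1 (0 : vec)).
Qed.

Lemma deg_plane_graph (x : vertex plane_graph) (f : F -> vec + option F) :
  injective f -> (forall c, point_ok (f c)) ->
  (forall c, point_adj (val x) (f c)) ->
  (#|F| <= #|nbr x|)%N.
Proof.
move=> finj fok fadj; rewrite -cardsT.
pose h c : vertex plane_graph := exist _ (f c) (fok c).
have hinj : injective h by move=> c c' /(congr1 val) /finj.
rewrite -(card_imset _ hinj).
apply/subset_leq_card/subsetP => _ /imsetP[c _ ->].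
by rewrite in_nbr /= fadj.
Qed.

(** [Mex] and [Mc4] concern degrees and 4-cycles at infinity. By [Mslope] and [Muniq] a vector loses
    at most one edge, and none if its slope is a unit slope. *)
Hypothesis Mex : {in R, forall s, exists2 z, z \in R & M s z}.
Hypothesis Mc4 : {in R & R, forall s s', s != s' ->
  {in R & R, forall z z', M s z -> M s' z -> M s z' -> M s' z' -> z = z'}}.
Hypothesis Mslope : forall s z, M s z -> z != perp s ->
  (s \in R) && (s \notin unit_slopes).
Hypothesis Muniq : forall s z z', M s z -> M s z' -> z != perp s ->
  z' != perp s -> z = z'.
Hypothesis unitR : unit_slopes \subset R.

(** Case analysis on which of the four points are at infinity. A cycle with two consecutive vectors
    followed by two points at infinity is broken by the removed edges; the other cases use
    [dot_line_inj], [dot_slope_inj], uniqueness of slopes, or [Mc4]. *)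
Lemma plane_graph_c4 : codeg_le1 plane_graph.
Proof.
suff c4 x x' y y' : point_ok x -> point_ok x' -> point_ok y -> point_ok y' ->
    x != x' -> point_adj x y -> point_adj x' y -> point_adj x y' ->
    point_adj x' y' -> y = y'.
  move=> x x' xx'; apply/card_le1_eqP => y' y; rewrite !in_setI !in_nbr.
  move=> /andP[xy' x'y'] /andP[xy x'y]; apply: val_inj.
  exact: (c4 _ _ _ _ (valP x) (valP x') (valP y) (valP y')).
case: x x' => [a|s] [a'|s'] /= ok ok' oky oky'.
- rewrite (inj_eq (@inl_inj _ _)) => aa'.
  case: y y' oky oky' => [b|z] [b'|z'] /= b0 b'0.
  + move=> /and3P[_ /eqP e1 _] /and3P[_ /eqP e2 _].
    move=> /and3P[_ /eqP e3 _] /and3P[_ /eqP e4 _].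
    by congr inl; apply: (dot_line_inj b0 b'0 aa').
  + move=> /and3P[_ /eqP e1 _] /and3P[_ /eqP e2 _] /eqP s1 /eqP s2.
    by case/eqP: aa'; apply: (dot_slope_inj (v := b)); rewrite ?s1 // dotC.
  + move=> /eqP s1 /eqP s2 /and3P[_ /eqP e1 _] /and3P[_ /eqP e2 _].
    by case/eqP: aa'; apply: (dot_slope_inj (v := b')); rewrite ?s1 // dotC.
  by move=> /eqP <- _ /eqP <-.
- move=> _; case: y y' oky oky' => [b|z] [b'|z'] /= b0 b'0.
  + move=> /and3P[_ /eqP e1 _] /eqP s1 /and3P[_ /eqP e2 _] /eqP s2.
    by congr inl; apply: (dot_slope_inj (v := a)); rewrite ?s1.
  + move=> /and3P[_ _ /negP nM] /eqP s1 /eqP s2 m.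
    by case: nM; rewrite s1 s2 Msym.
  + move=> /eqP s2 m /and3P[_ _ /negP nM] /eqP s1.
    by case: nM; rewrite s1 s2 Msym.
  by move=> /eqP <- _ /eqP <-.
- move=> _; case: y y' oky oky' => [b|z] [b'|z'] /= b0 b'0.
  + move=> /eqP s1 /and3P[_ /eqP e1 _] /eqP s2 /and3P[_ /eqP e2 _].
    by congr inl; apply: (dot_slope_inj (v := a')); rewrite ?s1.
  + move=> /eqP s1 /and3P[_ _ /negP nM] m /eqP s2.
    by case: nM; rewrite s1 s2 Msym.
  + move=> m /eqP s2 /eqP s1 /and3P[_ _ /negP nM].
    by case: nM; rewrite s1 s2 Msym.
  by move=> _ /eqP <- _ /eqP <-.
rewrite (inj_eq (@inr_inj _ _)) => ss'.
case: y y' oky oky' => [b|z] [b'|z'] /= b0 b'0.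
- by move=> /eqP s1 /eqP s2; case/eqP: ss'; rewrite -s1.
- by move=> /eqP s1 /eqP s2; case/eqP: ss'; rewrite -s1.
- by move=> _ _ /eqP s1 /eqP s2; case/eqP: ss'; rewrite -s1.
by move=> *; congr inr; apply: (Mc4 ok ok' ss').
Qed.

Lemma unit_dot_neq_perp v w :
  v != 0 -> dot v w = 1 -> slope w != perp (slope v).
Proof. by move=> v0 e; rewrite -dot_eq0 ?(dot_neq0 e) // e oner_eq0. Qed.

(* At most one [b] with [dot v b = 1] fails to be a neighbour of [v]; the point
   at infinity [slope v] then replaces it. *)
Lemma plane_graph_deg x : (#|F| <= #|nbr (x : vertex plane_graph)|)%N.
Proof.
case: x => [[v|s] ok].
  pose bad c := ~~ point_adj (inl v) (inl (line_pt v c)).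
  pose f c : vec + option F :=
    if bad c then inr (slope v) else inl (line_pt v c).
  have badE c : bad c -> v = line_pt v c \/ M (slope v) (slope (line_pt v c)).
    rewrite /bad /= dot_line_pt // eqxx /= negb_and !negbK.
    by case/orP=> [/eqP|]; [left|right].
  have unit_bad c : v = line_pt v c -> slope v \in unit_slopes.
    by move=> e; apply: unit_slopeP; rewrite {2}e dot_line_pt.
  have perp_pt c : slope (line_pt v c) != perp (slope v).
    by apply: unit_dot_neq_perp; rewrite ?dot_line_pt.
  have badR c : bad c -> slope v \in R.
    case/badE => [/unit_bad|/Mslope/(_ (perp_pt c))/andP[]//].
    exact: (subsetP unitR).
  (* A loop needs a unit slope and a removed edge a non-unit one, so they exclude each other. Two
     removed edges lead to equal slopes by [Muniq]. *)
  have bad_inj c c' : bad c -> bad c' -> c = c'.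
    move=> /badE h /badE h'; apply: (@line_pt_inj _ v).
    case: h h' => [e|m] [e'|m']; first by rewrite -e.
    - by have := Mslope m' (perp_pt c'); rewrite (unit_bad c e) andbF.
    - by have := Mslope m (perp_pt c); rewrite (unit_bad c' e') andbF.
    have d := @dot_line_pt _ v _ ok.
    apply: (dot_slope_inj (v := v)); rewrite ?(dot_neq0 (d _)) ?d //.
    exact: Muniq m m' (perp_pt c) (perp_pt c').
  apply: (deg_plane_graph (f := f)) => [c c'|c|c]; rewrite /f.
  - case: ifP => bc; case: ifP => bc' //; first by move=> _; apply: bad_inj.
    by case=> /line_pt_inj.
  - case: ifP => [/badR //|_ /=].
    by apply: (@dot_neq0 _ v); rewrite dot_line_pt.
  by case: ifPn => [|/negPn //]; rewrite /= eqxx.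
have [z zR sz] := Mex ok.
pose f c : vec + option F :=
  if c == 0 then inr z else inl (c * (dir s).1, c * (dir s).2).
apply: (deg_plane_graph (f := f)) => [c c'|c|c]; rewrite /f.
- case: eqP => [->|c0]; case: eqP => [->|c'0] // [e1 e2].
  case: (s) e1 e2 => [t|] /=; first by rewrite !mulr1.
  by rewrite !mulr1.
- by case: eqP => [//|/eqP c0] /=; apply: dir_neq0.
by case: eqP => [//|/eqP c0] /=; rewrite slope_dir.
Qed.

End PlaneGraph.

(** * Counting anisotropic slopes and slopes of unit vectors *)

Section Counting.
Variable F : finFieldType.
Local Notation vec := (F * F)%type.
Implicit Types (v w a b : vec) (s z : option F).
Local Open Scope ring_scope.

Lemma odd_card_two_neq0 : odd #|F| -> 2%:R != 0 :> F.
Proof.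
move=> odd_q; apply/negP => /eqP two0.
have : (1 : F) *+ #|F| = 0.
  by have := expg_cardG (in_setT (1 : F)); rewrite cardsT FinRing.zmodXgE.
rewrite -(odd_double_half #|F|) odd_q -mul2n natrD natrM two0 mul0r addr0.
by move/eqP; rewrite oner_eq0.
Qed.

Lemma exists_sqrt_N1 : #|F| = 1 %[mod 4] -> exists i : F, i ^+ 2 = -1.
Proof.
move=> q1; have q_gt1 := finNzRing_gt1 F.
pose j := (#|F| %/ 4)%N; have qE : #|F| = (j * 4).+1.
  by rewrite {1}(divn_eq #|F| 4) q1 addn1.
rewrite qE in q_gt1.
(* With [q = 4 * j + 1], the polynomial [X^(2j) - 1] has at most [2j] roots among the [4j] nonzero
   elements. For a non-root, [x^(2j) = -1]. *)
have [x x0 xj] : exists2 x : F, x != 0 & x ^+ (j * 2) != 1.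
  apply/exists_inP; rewrite -negb_forall_in; apply/negP => /forall_inP h.
  have := @max_unity_roots F (j * 2) (enum (predC1 (0 : F))) _ _ (enum_uniq _).
  rewrite -cardE cardC1 qE /= => /(_ ltac:(lia)) H.
  suff /H : all (j * 2).-unity_root (enum (predC1 (0 : F))) by lia.
  by apply/allP => x; rewrite mem_enum => /h; rewrite unity_rootE.
exists (x ^+ j); rewrite -exprM; apply/eqP; move: xj.
have : (x ^+ (j * 2)) ^+ 2 = 1.
  apply: (mulfI x0); rewrite mulr1 -exprM -exprS.
  by rewrite -[RHS]expf_card qE; congr (_ ^+ _); lia.
by move/eqP; rewrite sqrf_eq1 => /orP[->|].
Qed.

Lemma perp_N1 (a : F) : (perp (Some a) == Some a) = (a ^+ 2 == -1).
Proof.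
by rewrite eq_sym -dot_dir_eq0 /dot /= mulr1 addrC addr_eq0 expr2.
Qed.

Lemma card_sqrt_N1 : (#|[set a : F | a ^+ 2 == -1%R]| <= 2)%N.
Proof.
have [->|[a]] := set_0Vmem [set a : F | a ^+ 2 == -1]; first by rewrite cards0.
rewrite inE => /eqP aE.
apply: leq_trans (_ : #|[set a; -a]| <= 2)%N; last first.
  by rewrite cards2; case: (_ != _).
by apply/subset_leq_card/subsetP => b; rewrite !inE -aE eqf_sqr.
Qed.

Definition anisotropic : {set option F} := [set s | perp s != s].

(** Of the [q + 1] slopes, the isotropic ones are the square roots of -1, at most two. *)
Lemma card_anisotropic : (#|F| - 1 <= #|anisotropic|)%N.
Proof.
have cE : (#|anisotropic| + #|~: anisotropic| = #|F|.+1)%N.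
  by rewrite cardsC card_option.
suff : (#|~: anisotropic| <= 2)%N by lia.
apply: leq_trans card_sqrt_N1.
rewrite -[X in (_ <= X)%N](card_imset _ (@Some_inj _)).
apply/subset_leq_card/subsetP => s.
rewrite !inE negbK; case: s => [a|//]; rewrite perp_N1 => aE.
by apply/imsetP; exists a; rewrite // inE.
Qed.

Lemma perp_anisotropic : {in anisotropic, forall s, perp s \in anisotropic}.
Proof. by move=> s; rewrite !inE perpK eq_sym. Qed.

Lemma unit_slopes_anisotropic : unit_slopes F \subset anisotropic.
Proof.
apply/subsetP => _ /imsetP[v + ->]; rewrite !inE => /eqP e.
by rewrite eq_sym unit_dot_neq_perp ?(dot_neq0 e).
Qed.

Lemma perp_unit_slopes : {in unit_slopes F, forall s, perp s \in unit_slopes F}.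
Proof.
move=> _ /imsetP[v + ->]; rewrite !inE => /eqP e.
(* The quarter turn of [v] has the same norm and is orthogonal to [v]. *)
pose w : vec := (- v.2, v.1).
have e' : dot w w = 1 by rewrite -e /dot /=; ring.
have /eqP <- : slope w == perp (slope v).
  by rewrite -dot_eq0 ?(dot_neq0 e) ?(dot_neq0 e') // /dot /=; apply/eqP; ring.
exact: unit_slopeP.
Qed.

Hypothesis odd_q : odd #|F|.

Let two_neq0 := odd_card_two_neq0 odd_q.

(* Stereographic projection from (-1, 0). *)
Lemma card_unit_vectors :
  (#|[set v : vec | dot v v == 1%R]| <= #|[set k : F | k ^+ 2 != -1%R]|.+1)%N.
Proof.
(* The centre of projection accounts for the successor in the bound. *)
rewrite (cardsD1 (-1, 0)) -add1n leq_add //; first by case: (_ \in _).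
set U := _ :\ _.
have U1 v : v \in U -> 1 + v.1 != 0 /\ v.2 ^+ 2 = (1 + v.1) * (1 - v.1).
  rewrite !inE => /andP[v1 /eqP e].
  have e2 : v.2 ^+ 2 = (1 + v.1) * (1 - v.1).
    by transitivity (dot v v - v.1 ^+ 2); [rewrite /dot|rewrite e]; ring.
  split=> //; apply: contra v1 => h; rewrite (eqP h) mul0r in e2.
  move/eqP: e2; rewrite expf_eq0 /= => v2.
  by rewrite addrC addr_eq0 in h; case: v v2 h {e} => x y /= /eqP-> /eqP->.
pose k v := v.2 / (1 + v.1).
(* This identity recovers [v.1] from [k v] and, as 2 is nonzero, shows that [k v ^+ 2 != -1]. *)
have kE v : v \in U -> (1 + k v ^+ 2) * (1 + v.1) = 2%:R.
  case/U1=> h e; rewrite /k expr_div_n e; by field.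
have kinj : {in U &, injective k}.
  move=> v w vU wU kvw; have e : 1 + v.1 = 1 + w.1.
    have := kE v vU; rewrite -(kE w wU) kvw; apply: mulfI.
    by apply: contraNneq two_neq0 => h; rewrite -(kE w wU) h mul0r.
  have e2 : v.2 = w.2.
    by move: kvw; rewrite /k e; apply: mulIf; rewrite invr_eq0; case: (U1 w wU).
  by move/addrI: e; case: v w e2 {vU wU kvw} => [? ?] [? ?] /= -> ->.
rewrite -(card_in_imset kinj).
apply/subset_leq_card/subsetP => _ /imsetP[v vU ->].
rewrite inE -addr_eq0 addrC; apply: contraNneq two_neq0 => h.
by rewrite -(kE v vU) h mul0r.
Qed.

(* [v] and [-v] have the same slope. *)
Lemma card_unit_slopes :
  (#|unit_slopes F|.*2 <= #|[set v : vec | dot v v == 1%R]|)%N.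
Proof.
rewrite -muln2 -sum_nat_const -[X in (_ <= X)%N]sum1_card.
rewrite (partition_big (@slope F) (mem (unit_slopes F))) /=; last first.
  by move=> v; rewrite inE => /eqP /unit_slopeP.
apply: leq_sum => _ /imsetP[v + ->]; rewrite !inE => /eqP e.
have v0 : v != 0 := dot_neq0 e.
rewrite sum1dep_card; apply/card_gt1P; exists v, (- v.1, - v.2).
rewrite !inE e !eqxx /dot /= !mulrNN -/(dot v v) e eqxx.
split=> //.
  have /slopeP[d d0 ev] := v0.
  have -> : (- v.1, - v.2) = (- d * (dir (slope v)).1, - d * (dir (slope v)).2).
    by rewrite !mulNr [in LHS]ev.
  by rewrite slope_dir ?oppr_eq0 ?eqxx.
apply: contra v0 => /eqP h.
have z (x : F) : x = - x -> x = 0.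
  move=> /eqP; rewrite -addr_eq0 -mulr2n -mulr_natr mulf_eq0.
  by rewrite (negbTE two_neq0) orbF => /eqP.
by case: v h {e} => x y /= [/z-> /z->].
Qed.

Lemma card_unit_slopes_le : (#|unit_slopes F| <= (#|F| + 1) %/ 2)%N.
Proof.
have := card_unit_slopes; have := card_unit_vectors.
have : (#|[set k : F | k ^+ 2 != -1%R]| <= #|F|)%N by exact: max_card.
lia.
Qed.

(** Here the projection also misses the two values [i] and [- i], which lowers the bound by one. *)
Lemma card_unit_slopes_le1 : #|F| = 1 %[mod 4] ->
  (#|unit_slopes F| <= (#|F| - 1) %/ 2)%N.
Proof.
move=> /exists_sqrt_N1[i iE].
have : (#|[set i; -i]| + #|[set k : F | k ^+ 2 != -1%R]| <= #|F|)%N.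
  rewrite -cardsUI [X in (_ + X)%N]eq_card0 ?addn0; first exact: max_card.
  move=> k; rewrite !inE; apply/negP => /andP[/orP[]/eqP->].
    by rewrite iE eqxx.
  by rewrite sqrrN iE eqxx.
have i_neq : i != - i.
  apply: contraNneq two_neq0 => h.
  have : i * 2%:R = 0 by rewrite mulr_natr mulr2n {2}h subrr.
  move/eqP; rewrite mulf_eq0 => /orP[/eqP i0|/eqP//].
  by move/eqP: iE; rewrite i0 expr0n /= eq_sym oppr_eq0 oner_eq0.
rewrite cards2 i_neq; have := card_unit_slopes; have := card_unit_vectors; lia.
Qed.

End Counting.

(** * Extremal graphs for even and odd [t] *)

Section LowerBound.
Variable F : finFieldType.
Local Notation q := #|F|.

Lemma plane_graph_not_ramsey (R : {set option F}) (M : rel (option F)) n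
    (Msym : symmetric M) (Mirr : irreflexive M) :
  {in R, forall s, exists2 z, z \in R & M s z} ->
  {in R & R, forall s s', s != s' ->
    {in R & R, forall z z', M s z -> M s' z -> M s z' -> M s' z' -> z = z'}} ->
  (forall s z, M s z -> z != perp s -> (s \in R) && (s \notin unit_slopes F)) ->
  (forall s z z', M s z -> M s z' -> z != perp s -> z' != perp s -> z = z') ->
  unit_slopes F \subset R -> q ^ 2 - 1 + #|R| < n + 2 * q + 1 ->
  ~ ramsey_prop (cycle_graph 4) (book_graph n) (q ^ 2 - 1 + #|R|).
Proof.
move=> Mex Mc4 Mslope Muniq unitR; rewrite -(card_plane_graph R Msym Mirr).
apply: min_deg_not_ramsey.
  exact: (plane_graph_c4 Mc4).
exact: (plane_graph_deg Mex Mslope Muniq unitR).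
Qed.

Lemma perp_eqC (s z : option F) : (s == perp z) = (z == perp s).
Proof. by rewrite -(inv_eq (@perpK F)) eq_sym. Qed.

Lemma exists_slopes m : #|unit_slopes F| <= m.*2 <= q - 1 ->
  exists R : {set option F}, [/\ #|R| = m.*2, unit_slopes F \subset R,
    R \subset anisotropic F & {in R, forall s, perp s \in R}].
Proof.
case/andP=> um mq; apply: exists_stable_set.
- exact: perpK.
- exact: perp_anisotropic.
- by move=> s; rewrite inE.
- exact: perp_unit_slopes.
- exact: unit_slopes_anisotropic.
by rewrite um (leq_trans mq) // card_anisotropic.
Qed.

Lemma lower_bound_even m n : #|unit_slopes F| <= m.*2 <= q - 1 ->
  q ^ 2 - 1 + m.*2 < n + 2 * q + 1 ->
  ~ ramsey_prop (cycle_graph 4) (book_graph n) (q ^ 2 - 1 + m.*2).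
Proof.
move=> /exists_slopes[R [<- unitR Raniso Rperp]].
pose M := [rel s z : option F | (s != z) && (z == perp s)].
apply: (plane_graph_not_ramsey (M := M)) => //.
- by move=> s z /=; rewrite eq_sym perp_eqC.
- by move=> s /=; rewrite eqxx.
- move=> s sR; exists (perp s); first exact: Rperp.
  by have := subsetP Raniso s sR; rewrite inE /= eqxx eq_sym => ->.
- by move=> s s' _ _ _ z z' _ _ /andP[_ /eqP->] _ /andP[_ /eqP->].
- by move=> s z /andP[_ ->].
by move=> s z z' /andP[_ ->].
Qed.

(** The strict inequalities leave room for a non-unit slope [a] in [R] and an anisotropic slope [e]
    outside [R]; [e] is then added to [R]. *)
Lemma lower_bound_odd m n : #|unit_slopes F| < m.*2 < q - 1 ->
  q ^ 2 - 1 + m.*2.+1 < n + 2 * q + 1 ->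
  ~ ramsey_prop (cycle_graph 4) (book_graph n) (q ^ 2 - 1 + m.*2.+1).
Proof.
case/andP=> um mq.
have [|R [cR unitR Raniso Rperp]] := @exists_slopes m.
  by rewrite (ltnW um) (ltnW mq).
have /subsetPn[a aR aN] : ~~ (R \subset unit_slopes F).
  by apply: contraL um => /subset_leq_card; rewrite cR leqNgt.
have /subsetPn[e eA eR] : ~~ (anisotropic F \subset R).
  apply: contraL mq => /subset_leq_card; rewrite cR -leqNgt.
  by apply: leq_trans; exact: card_anisotropic.
have eN : e \notin unit_slopes F by apply: contra eR => /(subsetP unitR).
have ae : a != e by apply: contraNneq eR => <-.
have pe : perp e \notin R by apply: contra eR => /Rperp; rewrite perpK.
pose M := [rel s z : option F | (s != z) && [|| z == perp s,
  (s == a) && (z == e) | (s == e) && (z == a)]].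
have cRe : #|e |: R| = m.*2.+1 by rewrite cardsU1 eR cR.
rewrite -cRe.
have Msym : symmetric M.
  move=> s z /=; rewrite eq_sym perp_eqC; congr (_ && (_ || _)).
  by rewrite orbC; congr (_ || _); rewrite andbC.
(* Within [e |: R] only [a] can have two neighbours, since [perp e] lies outside [R]. So two
   distinct slopes have no common neighbour but [a]. *)
have nbr_uniq s z z' : s != a -> z \in e |: R -> z' \in e |: R ->
    M s z -> M s z' -> z = z'.
  move=> sa; have [->|se] := eqVneq s e; last first.
    rewrite /= (negbTE sa) (negbTE se) !orbF.
    by move=> _ _ /andP[_ /eqP->] /andP[_ /eqP->].
  have only_a y : y \in e |: R -> M e y -> y = a.
    rewrite !inE /= [e == a]eq_sym (negbTE ae) eqxx /= eq_sym.
    case: eqP => //= ye yR /orP[/eqP yp|/eqP//].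
    by rewrite yp (negbTE pe) in yR.
  by move=> zR z'R /(only_a _ zR) -> /(only_a _ z'R) ->.
apply: (plane_graph_not_ramsey (M := M)) => //.
- by move=> s /=; rewrite eqxx.
- move=> s; rewrite !inE => /predU1P[->|sR].
    by exists a; rewrite ?inE ?aR ?orbT //= eq_sym ae !eqxx !orbT.
  exists (perp s); first by rewrite inE Rperp ?orbT.
  by have := subsetP Raniso s sR; rewrite inE /= eqxx eq_sym => ->.
- move=> s s' sR s'R ss' z z' zR z'R sz s'z sz' s'z'.
  have eq_a y : M s y -> M s' y -> y = a.
    move=> sy s'y; apply/eqP; apply: contraNT ss' => ya; apply/eqP.
    have ys : M y s by rewrite [M y s]Msym.
    have ys' : M y s' by rewrite [M y s']Msym.
    exact: (nbr_uniq y s s').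
  by have -> := eq_a z sz s'z; have -> := eq_a z' sz' s'z'.
- move=> s z /= /andP[_ /or3P[->//|/andP[/eqP-> _] _|/andP[/eqP-> _] _]].
    by rewrite in_setU1 aR orbT.
  by rewrite in_setU1 eqxx.
- move=> s z z' /= /andP[_ h] /andP[_ h'] nz nz'.
  move: h h'; rewrite (negbTE nz) (negbTE nz') /=.
  case/orP=> /andP[/eqP-> /eqP->] /orP[] /andP[/eqP h /eqP ->] //.
exact: subset_trans unitR (subsetUr _ _).
Qed.

End LowerBound.

Theorem theorem3 (q t : nat) (q_ge5 : 5 <= q) (q_odd : odd q)
  (q_pp : prime_power q)
  (ht : [/\ q = 3 %[mod 4], (q + 1) %/ 2 <= t, t <= q - 1
          & t <> (q + 3) %/ 2]
     \/ [/\ q = 1 %[mod 4], (q - 1) %/ 2 <= t, t <= q - 1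
          & t <> (q + 1) %/ 2]) :
  is_ramsey_number (cycle_graph 4) (book_graph ((q - 1) ^ 2 + (t - 2)))
    (q ^ 2 + t).
Proof.
have t_lt : t < q by case: ht => -[_ _ h _]; lia.
have t_ge2 : 2 <= t by case: ht => -[h1 h2 _ _]; lia.
(* As [2 <= t], this gives [n + 2 * q + 1 = q ^ 2 + t] for the book parameter [n]. *)
have sq : (q - 1) ^ 2 + 2 * q = q ^ 2 + 1 by rewrite -!mulnn; nia.
split; first by apply: upper_bound => //; lia.
have [p [k [p_pr k_gt0 qE]]] := q_pp.
have [F _ cF] := pPrimePowerField p_pr k_gt0; rewrite -qE in cF.
have not_small : ~ ramsey_prop (cycle_graph 4)
    (book_graph ((q - 1) ^ 2 + (t - 2))) (q ^ 2 - 1 + t).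
  have odd_F : odd #|F| by rewrite cF.
  (* The lower end of the range of [t] is even in both cases and the excluded value is its
     successor. An odd [t] therefore exceeds that end by at least 3, which gives the strict
     bound. *)
  have unit_t : #|unit_slopes F| <= t /\ (odd t -> #|unit_slopes F| < t.-1).
    case: ht => -[q4 t_ge _ t_neq].
      by have := card_unit_slopes_le odd_F; rewrite cF; lia.
    by have := card_unit_slopes_le1 odd_F; rewrite cF; lia.
  case: unit_t => unit_le unit_lt.
  have [t_odd|t_even] := boolP (odd t).
    have tE : t = t./2.*2.+1 by rewrite -{1}(odd_double_half t) t_odd.
    rewrite {2}tE -cF; apply: lower_bound_odd; rewrite ?cF; lia.
  have tE : t = t./2.*2 by rewrite -{1}(odd_double_half t) (negbTE t_even).
  rewrite {2}tE -cF; apply: lower_bound_even; rewrite ?cF; lia.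
move=> M hM; rewrite leqNgt; apply/negP => ltM; apply: not_small.
by apply: ramsey_prop_mono hM _; lia.
Qed.
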